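(* Let $\mathcal L$ be a special Lusin family on $\mathbb N$. (1) $\mathcal L^\star$ is a special Lusin family (on the countable set of nonempty finite subsets of $\mathbb N$). (2) $G(K_{\mathcal L})=K_{\mathcal L^\star}$ (up to the canonical homeomorphism) and $K_{\mathcal L^\star}$ admits a continuous join semilattice structure.
   Context: A family $\mathcal A$ of infinite subsets of $S$ is almost disjoint if $A\cap B$ is finite for distinct $A,B\in\mathcal A$. A special Lusin family on a countable set $N$ is an almost disjoint family of infinite subsets of $N$ with an enumeration $\{A_\alpha:\alpha<\omega_1\}$ (without repetition) such that for every $\alpha<\omega_1$ and every finite $s\subseteq N$, the set $\{\xi<\alpha: A_\xi\cap A_\alpha\subseteq s\}$ is finite. For an infinite almost disjoint family $\mathcal A$ on $S$, $K_{\mathcal A}=S\cup\mathcal A\cup\{\infty\}$ is the one-point compactification (with point $\infty$) of the locally compact space $S\cup\mathcal A$ in which points of $S$ are isolated and basic neighborhoods of $A\in\mathcal A$ are $\{A\}\cup(A\setminus F)$, $F\subseteq A$ finite. It is ordered by the clopen selector $U_s=\{s\}$, $U_A=A\cup\{A\}$, $U_\infty=K_{\mathcal A}$: $x\le y$ iff $U_x\subseteq U_y$. For a set $I$, $[I]^{<\omega}_*$ is the set of nonempty finite subsets of $I$. $\mathcal L^\star=\{A^\star:A\in\mathcal L\}$ with $A^\star=[A]^{<\omega}_*$, a family on $S^\star=[\mathbb N]^{<\omega}_*$. $H(K_{\mathcal L})$ is the set of nonempty closed initial (downward closed) subsets of $K_{\mathcal L}$, with the topology generated by $U^+=\{K:K\subseteq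 U\}$ and $V^-=\{K:K\cap V\ne\emptyset\}$ for $U$ clopen initial and $V$ clopen final. $G(K_{\mathcal L})$ is the quotient of $H(K_{\mathcal L})$ obtained by collapsing to one point $\infty$ the closed set of all members other than the nonempty finite subsets of $\mathbb N$ and the sets $A\cup\{A\}$, $A\in\mathcal L$. The canonical homeomorphism $K_{\mathcal L^\star}\to G(K_{\mathcal L})$ sends $F\in S^\star$ to the class of $F$, $A^\star$ to the class of $A\cup\{A\}$, and the point at infinity to $\infty$. A continuous join semilattice structure on a space is a continuous associative, commutative, idempotent binary operation. *)

(* Defs.v *)
From HB Require Import structures.
From mathcomp Require Import all_boot finmap generic_quotient.
From mathcomp Require Import all_classical topology.

Set Implicit Arguments.
Unset Strict Implicit.
Unset Printing Implicit Defensive.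

Local Open Scope classical_set_scope.
Local Open Scope quotient_scope.

Definition almost_disjoint (S : Type) (A : set (set S)) : Prop :=
  (forall X, A X -> infinite_set X) /\
  (forall X Y, A X -> A Y -> X <> Y -> finite_set (X `&` Y)).

(* [R] is the non-strict order.  These conditions characterize omega_1 up to
   order isomorphism. *)
Definition is_omega1 (W : Type) (R : rel W) : Prop :=
  [/\ wochoice.well_order R,
      forall a, countable [set x | R x a]
    & ~ countable [set: W]].

Definition special_lusin (N : Type) (L : set (set N)) : Prop :=
  [/\ countable [set: N],
      almost_disjoint L
    & exists (W : Type) (R : rel W) (e : W -> set N),
        [/\ is_omega1 R, injective e, range e = L
          & forall (a : W) (s : set N), finite_set s ->
              finite_set [set x | [/\ R x a, x <> a & e x `&` e a `<=` s]]]].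

Definition psi_space (S : choiceType) (A : set (set S)) : Type := (S + A)%type.

Section PsiSpace.
Context {S : choiceType} (A : set (set S)).

HB.instance Definition _ := Choice.copy (psi_space A) (S + A)%type.

Definition psi_nbhs (x : psi_space A) : set_system (psi_space A) :=
  match x with
  | inl s => principal_filter (inl s : psi_space A)
  | inr X => filter_from [set F : set S | finite_set F /\ F `<=` val X]
               (fun F => [set (inr X : psi_space A)] `|`
                         [set inl s | s in val X `\` F])
  end.

Let psi_filter (x : psi_space A) : ProperFilter (psi_nbhs x).
Proof.
case: x => [s|X] /=; first exact: principal_filter_proper.
apply: filter_from_proper; last by move=> F _; exists (inr X); left.
apply: filter_from_filter; first by exists set0; split.
move=> F G [finF FX] [finG GX]; exists (F `|` G).
  by split; [rewrite finite_setU | rewrite subUset].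
move=> y [->|[s [Xs nFG] <-]]; first by split; left.
by split; right; exists s => //; split=> // h; apply: nFG; [left|right].
Qed.

Let psi_singleton (x : psi_space A) (U : set (psi_space A)) :
  psi_nbhs x U -> U x.
Proof.
by case: x => [s|X] /=; [by move/principal_filterP | case=> F _; apply; left].
Qed.

Let psi_nbhs_nbhs (x : psi_space A) (U : set (psi_space A)) :
  psi_nbhs x U -> psi_nbhs x (psi_nbhs^~ U).
Proof.
case: x => [s|X] /=.
  by move=> Us; apply/principal_filterP.
case=> F FX FU; exists F => // y [->|[s Xs <-]] /=; first by exists F.
by apply/principal_filterP; apply: FU; right; exists s.
Qed.

HB.instance Definition _ := hasNbhs.Build (psi_space A) psi_nbhs.
HB.instance Definition _ := @Nbhs_isNbhsTopological.Build (psi_space A)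
  psi_filter psi_singleton psi_nbhs_nbhs.

End PsiSpace.

Notation K_ A := (one_point_compactification (psi_space A)).

Section OrderedCompactum.
Context {S : choiceType} {A : set (set S)}.

Definition K_pt (s : S) : K_ A := Some (inl s).
Definition K_set (X : A) : K_ A := Some (inr X).
Definition K_infty : K_ A := None.

Definition selector (x : K_ A) : set (K_ A) :=
  match x with
  | Some (inl s) => [set K_pt s]
  | Some (inr X) => [set K_pt s | s in val X] `|` [set K_set X]
  | None => setT
  end.

Definition K_le (x y : K_ A) : Prop := selector x `<=` selector y.

Definition initial (U : set (K_ A)) : Prop :=
  forall x y, K_le x y -> U y -> U x.

Definition final (U : set (K_ A)) : Prop :=
  forall x y, K_le x y -> U x -> U y.

End OrderedCompactum.

Definition hyperspace (S : choiceType) (A : set (set S)) : Type :=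
  {C : set (K_ A) | C \in [set C | [/\ C !=set0, closed C & initial C]]}.

Section Hyperspace.
Context {S : choiceType} (A : set (set S)).

HB.instance Definition _ := Choice.copy (hyperspace A)
  {C : set (K_ A) | C \in [set C | [/\ C !=set0, closed C & initial C]]}.

Definition hyper_plus (U : set (K_ A)) : set (hyperspace A) :=
  [set C | sval C `<=` U].

Definition hyper_minus (V : set (K_ A)) : set (hyperspace A) :=
  [set C | sval C `&` V !=set0].

Definition hyper_subbase : set (set (hyperspace A)) :=
  [set hyper_plus U | U in [set U | clopen U /\ initial U]] `|`
  [set hyper_minus V | V in [set V | clopen V /\ final V]].

HB.instance Definition _ := @isSubBaseTopological.Build (hyperspace A)
  (set (hyperspace A)) hyper_subbase id.

End Hyperspace.

Definition nefset (I : choiceType) := {F : {fset I} | F != fset0}.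

HB.instance Definition _ (I : choiceType) :=
  Choice.copy (nefset I) {F : {fset I} | F != fset0}.

Definition nefset_set (I : choiceType) (F : nefset I) : set I := [set` val F].

Definition star (I : choiceType) (A : set I) : set (nefset I) :=
  [set F | nefset_set F `<=` A].

Definition star_family (I : choiceType) (L : set (set I)) :
  set (set (nefset I)) := [set star A | A in L].

Section CollapsedHyperspace.
Context {S : choiceType} (A : set (set S)).

Definition fin_member (F : nefset S) (C : hyperspace A) : Prop :=
  sval C = [set K_pt s | s in nefset_set F].

Definition set_member (X : A) (C : hyperspace A) : Prop :=
  sval C = [set K_pt s | s in val X] `|` [set K_set X].

Definition collapsed (C : hyperspace A) : Prop :=
  ~ (exists F, fin_member F C) /\ ~ (exists X, set_member X C).

Definition collapse_rel (C D : hyperspace A) : bool :=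
  `[< C = D \/ (collapsed C /\ collapsed D) >].

Let collapse_refl : reflexive collapse_rel.
Proof. by move=> C; apply/asboolP; left. Qed.

Let collapse_sym : symmetric collapse_rel.
Proof.
by move=> C D; apply/asboolP/asboolP => -[->|[? ?]]; by [left | right].
Qed.

Let collapse_trans : transitive collapse_rel.
Proof.
move=> D C E /asboolP[->//|[cC cD]] /asboolP[<-|[_ cE]];
  by apply/asboolP; right.
Qed.

Canonical collapse_equiv :=
  EquivRel collapse_rel collapse_refl collapse_sym collapse_trans.

Definition G_space : Type := quotient_topology {eq_quot collapse_rel}.

Definition G_class (C : hyperspace A) : G_space :=
  \pi_(quotient_topology {eq_quot collapse_rel}) C.

End CollapsedHyperspace.

(* The existentials only name members of the hyperspace: a member is determined
   by its underlying set, and all collapsed members have the same class. *)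
Definition canonical_map (S : choiceType) (L : set (set S))
    (h : K_ (star_family L) -> G_space L) : Prop :=
  [/\ forall F : nefset S,
        exists2 C, fin_member F C & h (K_pt F) = G_class C,
      forall (A : L) (B : star_family L), val B = star (val A) ->
        exists2 C, set_member A C & h (K_set B) = G_class C
    & exists2 C, collapsed C & h K_infty = G_class C].

Definition homeomorphism (X Y : topologicalType) (h : X -> Y) : Prop :=
  continuous h /\
  exists g : Y -> X, [/\ cancel h g, cancel g h & continuous g].

Definition join_semilattice_op (X : topologicalType) (op : X -> X -> X) : Prop :=
  [/\ associative op, commutative op, (forall x, op x x = x)
    & continuous (fun p : X * X => op p.1 p.2)].

(* Main.v *)
Require Import Defs.
From mathcomp Require Import all_boot finmap generic_quotient.
From mathcomp Require Import all_classical topology.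

(** Attach to each point [x] of [K_ (star_family L)] a closed initial subset
    [trace x] of [K_ L]: the finite set [F] to [F], the point [star A] to the
    selector of [A], and [K_infty] to the whole space.  Conversely, [collapse]
    sends a trace to its point and every other closed initial set to [K_infty].
    Thus [collapse] is a retraction of the hyperspace onto the compactum, and
    its kernel is exactly the relation that defines the collapsed hyperspace.

    Everything rests on two facts.  First, the lower sets
    [[set x | trace x `<=` trace (Some p)]], where [Some p] runs through the
    points other than [K_infty], are clopen and separate points
    ([trace_lower_clopen], [trace_separates]); as the compactum is compact, a
    map into it is continuous as soon as the preimages of these sets are clopen
    ([continuous_trace_lower]).  Second, a nonempty closed initial set contained
    in [trace (Some p)] is a trace ([trace_sub_trace]), whence
    [trace (collapse C) `<=` trace (Some p)] exactly when
    [C `<=` trace (Some p)] ([trace_collapse]).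

    The preimage under [collapse] of a lower set is therefore a clopen set
    [hyper_plus U], so [collapse] is continuous and induces a continuous
    bijection from the collapsed hyperspace to the compactum.  The hyperspace is
    compact ([compact_hyperspace]) and the compactum is Hausdorff, so this
    bijection is a homeomorphism; its inverse is the canonical map.

    The join of [x] and [y] is the collapse of [trace x `|` trace y].  It lies
    below [Some p] exactly when [x] and [y] do ([trace_join_lower]).  Since the
    lower sets separate points this yields the semilattice laws, and it exhibits
    the preimages of the lower sets as products of clopen sets, which gives
    continuity.

    That the starred family is again a special Lusin family, with the starred
    enumeration, is a matter of finite sets: [star] commutes with intersections,
    and [star X] is finite exactly when [X] is. *)

Set Implicit Arguments.
Unset Strict Implicit.
Unset Printing Implicit Defensive.

Local Open Scope classical_set_scope.

(** * Clopen sets and compact spaces *)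

Lemma clopen_bigcup_finite (T : topologicalType) (I : choiceType) (D : set I)
    (F : I -> set T) :
  finite_set D -> (forall i, D i -> clopen (F i)) ->
  clopen (\bigcup_(i in D) F i).
Proof.
move=> finD clF; split; first by apply: bigcup_open => i /clF[].
by apply: closed_bigcup => // i /clF[].
Qed.

Lemma cluster_sub_closed (X : topologicalType) (F : set_system X) (Z : set X) :
  closed Z -> F Z -> cluster F `<=` Z.
Proof. by move=> clZ FZ y; rewrite clusterE => /(_ Z FZ); exact: clZ. Qed.

Section SeparatingClopens.
Context {X : topologicalType} {I : Type} (D : I -> set X).
Context (clD : forall i, clopen (D i)).
Context (sepD : forall x y, (forall i, D i x <-> D i y) -> x = y).

(** A filter that decides every [D i] as the point [x] does has no other cluster
    point: the sides it chooses are closed, and together they determine [x]. *)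
Lemma cluster_sub_separated (F : set_system X) (x : X) :
  (forall i, D i x -> F (D i)) -> (forall i, ~ D i x -> F (~` D i)) ->
  cluster F `<=` [set x].
Proof.
move=> FD FnD y cly; apply: sepD => i; have [oD cD] := clD i.
split=> [Dy|Dx]; last exact: (cluster_sub_closed cD (FD i Dx)).
apply: contrapT => nDx.
by have := cluster_sub_closed (open_closedC oD) (FnD i nDx) cly.
Qed.

Lemma hausdorff_separated : hausdorff_space X.
Proof.
move=> x y clxy; apply/esym/(@cluster_sub_separated (nbhs x)) => // i Dx;
  apply: open_nbhs_nbhs; split=> //; first by case: (clD i).
by apply: closed_openC; case: (clD i).
Qed.

(** In a compact space a separating family of clopen sets generates the
    topology, so it suffices to test continuity on it. *)
Lemma continuous_separated (T : topologicalType) (f : T -> X) :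
  compact [set: X] -> (forall i, clopen (f @^-1` D i)) -> continuous f.
Proof.
move=> cX clf t.
apply: (compact_cluster_set1 (V := [set: X])) => //.
- exact: hausdorff_separated.
- exact: filterT.
- exact: filterT.
rewrite eqEsubset; split=> [|_ ->]; last first.
  move=> P Q /nbhs_singleton/= Pft Qft.
  by exists (f t); split=> //; exact: nbhs_singleton.
apply: cluster_sub_separated => i Dft; apply: open_nbhs_nbhs; split=> //.
  by case: (clf i).
by rewrite preimage_setC; apply: closed_openC; case: (clf i).
Qed.

End SeparatingClopens.

Lemma compact_hausdorff_continuous_inverse (X Y : topologicalType)
    (f : X -> Y) (g : Y -> X) :
  compact [set: X] -> hausdorff_space Y -> continuous f ->
  cancel f g -> cancel g f -> continuous g.
Proof.
move=> cX hY cf fg gf; apply/continuous_closedP => Z clZ.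
have -> : g @^-1` Z = f @` Z.
  rewrite eqEsubset; split=> [y Zgy|_ [x Zx <-]]; last by rewrite /= fg.
  by exists (g y).
apply: compact_closed => //; apply: continuous_compact.
  exact: continuous_subspaceT.
exact: subclosed_compact cX _.
Qed.

(** * The compact space of an almost disjoint family *)

Section Compactum.
Context {S : choiceType} {A : set (set S)}.
Implicit Types (U : set (K_ A)) (s : S) (X : A).

Lemma nbhs_K_pt s U : U (K_pt s) -> nbhs (K_pt s) U.
Proof. by move=> Us; apply/principal_filterP. Qed.

(** The finite set removed in a basic neighbourhood inside [U] contains all the
    points of [val X] missing from [U], so these are the smallest choice. *)
Lemma nbhs_K_set X U : nbhs (K_set X) U <->
  U (K_set X) /\ finite_set [set s | val X s /\ ~ U (K_pt s)].
Proof.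
split=> [NU|[UX finU]].
  split; first exact: nbhs_singleton NU.
  case: NU => F [finF _] FU; apply: sub_finite_set finF => s [Xs nUs].
  by apply: contrapT => nFs; apply: nUs; apply: FU; right; exists s.
exists [set s | val X s /\ ~ U (K_pt s)]; first by split=> // s [].
move=> _ [->//|[s [Xs nUs] <-]] /=.
by apply: contrapT => h; apply: nUs.
Qed.

Lemma open_KP U : ~ U K_infty -> open U <->
  (forall X, U (K_set X) -> finite_set [set s | val X s /\ ~ U (K_pt s)]).
Proof.
move=> nU; rewrite openE; split=> [oU X UX|h].
  by have /nbhs_K_set[] := oU _ UX.
move=> [[s|X]|//] Ux; first exact: nbhs_K_pt.
by apply/nbhs_K_set; split=> //; exact: h.
Qed.

Lemma K_pt_inj : injective (@K_pt S A).
Proof. by move=> s t [->]. Qed.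

Lemma K_set_inj : injective (@K_set S A).
Proof. by move=> X Y [->]. Qed.

Lemma selector_pt X s : selector (K_set X) (K_pt s) <-> val X s.
Proof. by split=> [[[t Xt /K_pt_inj<-]|] //|Xs]; left; exists s. Qed.

Lemma selector_set X Y : selector (K_set X) (K_set Y) <-> Y = X.
Proof. by split=> [[[]|/K_set_inj]|->] //; right. Qed.

Lemma selector_infty (p : psi_space A) : ~ selector (Some p : K_ A) K_infty.
Proof. by case: p => [s|X] //= -[[]|]. Qed.

Lemma selector_self (p : psi_space A) : selector (Some p : K_ A) (Some p).
Proof. by case: p => [s|X] //=; right. Qed.

Context (Aad : almost_disjoint A).

(** Almost disjointness enters the topology here: when [K_set X] lies outside a
    selector, [val X] meets the selector in a finite set only, which keeps
    [K_set X] out of its closure. *)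
Lemma finite_selector_meet (p : psi_space A) X :
  ~ selector (Some p : K_ A) (K_set X) ->
  finite_set [set s | val X s /\ selector (Some p : K_ A) (K_pt s)].
Proof.
case: p => [s _|Y /selector_set nYX].
  by apply: sub_finite_set (finite_set1 s) => t [_ /K_pt_inj].
have XY : val X <> val Y by move=> /val_inj.
apply: sub_finite_set (proj2 Aad _ _ (set_mem (valP X)) (set_mem (valP Y)) XY).
by move=> s [Xs /selector_pt].
Qed.

(** Closedness at [K_infty] amounts to compactness of the selector in the
    uncompactified space: any neighbourhood of its top point [p] leaves out only
    finitely many of its points. *)
Lemma selector_clopen (p : psi_space A) : clopen (selector (Some p : K_ A)).
Proof.
(* the same set before the point at infinity is added *)
pose W := [set q : psi_space A | selector (Some p : K_ A) (Some q)].
have oW : open (selector (Some p : K_ A)).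
  apply/open_KP; first exact: selector_infty.
  move=> X; case: p {W} => [//|Y] /selector_set ->.
  by apply: sub_finite_set (finite_set0 _) => s [Ys []]; apply/selector_pt.
split=> //; rewrite -[selector _]setCK; apply: open_closedC.
have cW : closed W.
  rewrite -[W]setCK; apply: open_closedC; rewrite openE => q nWq.
  case: q nWq => [s|X] nWq; first exact/principal_filterP.
  exists [set s | val X s /\ selector (Some p : K_ A) (K_pt s)].
    by split; [exact: finite_selector_meet | move=> s []].
  by move=> _ [->//|[s [Xs ns] <-]] Ws; apply: ns.
rewrite openE => -[q|] nq.
  by move: cW => /closed_openC; rewrite openE; apply.
exists W; last by move=> _ [[q nWq <-]//|->]; exact: selector_infty.
split=> // F PF FW; apply: contrapT => noclF.
have : ~ cluster F p.
  by move=> clp; apply: noclF; exists p; split=> //; exact: selector_self.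
move=> /existsNP[V /existsNP[N /not_implyP[FV /not_implyP[Np VN]]]].
have finV : finite_set (W `\` N).
  case: p Np @W {oW cW nq noclF VN FW} => [s|X] Np W.
    by move: Np => /principal_filterP Ns;
      apply: sub_finite_set (finite_set0 _) => q [[->]].
  case: Np => G [finG GX] GN.
  apply: sub_finite_set (finite_image inl finG) => -[s|Y] [].
    move=> /selector_pt Xs nN; exists s => //; apply: contrapT => nGs.
    by apply: nN; apply: GN; right; exists s.
  by move=> /selector_set -> []; apply: GN; left.
have [|q [[Wq _] clq]] := finite_compact finV PF.
  apply: filterS (filterI FV FW) => q [Vq Wq]; split=> // Nq.
  by apply: VN; exists q.
by apply: noclF; exists q.
Qed.

End Compactum.

(** * Initial sets and compactness of the hyperspace *)

Section Initial.
Context {S : choiceType} {A : set (set S)}.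
Implicit Types (U V : set (K_ A)) (x y : K_ A).

Lemma selector_refl x : selector x x.
Proof. by case: x => [p|] //; exact: selector_self. Qed.

Lemma selector_le x y : selector x y -> K_le y x.
Proof.
case: x => [[s|X]|] //; first by move=> ->.
case: y => [[s|Y]|]; last by move=> /selector_infty.
  by move=> Xs _ ->.
by move=> /selector_set ->.
Qed.

Lemma initial_selector x : initial (selector x).
Proof. by move=> y z yz /selector_le; apply; exact/yz/selector_refl. Qed.

Lemma initial_bigcup (I : Type) (D : set I) (F : I -> set (K_ A)) :
  (forall i, D i -> initial (F i)) -> initial (\bigcup_(i in D) F i).
Proof. by move=> iF x y xy [i Di Fiy]; exists i => //; exact: iF xy Fiy. Qed.

Lemma initialU U V : initial U -> initial V -> initial (U `|` V).
Proof.
by move=> iU iV x y xy [Uy|Vy]; [left; exact: iU xy Uy|right; exact: iV xy Vy].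
Qed.

Lemma final_setC U : initial U -> final (~` U).
Proof. by move=> iU x y xy nUx Uy; apply: nUx; exact: iU xy Uy. Qed.

Lemma initial_setC U : final U -> initial (~` U).
Proof. by move=> iU x y xy nUx Uy; apply: nUx; exact: iU xy Uy. Qed.

End Initial.

Section HyperspaceTopology.
Context {S : choiceType} {A : set (set S)}.
Implicit Types (U V : set (K_ A)) (C : hyperspace A).

Lemma hyper_subbase_open (O : set (hyperspace A)) : hyper_subbase O -> open O.
Proof.
move=> sO; exists [set O]; last by rewrite bigcup_set1.
by move=> _ ->; exact: finI_from1.
Qed.

Lemma hyperspaceP C : [/\ sval C !=set0, closed (sval C) & initial (sval C)].
Proof. by case: C => C /= /set_mem. Qed.

Lemma hyper_minusC U :
  hyper_minus (~` U) = ~` hyper_plus U :> set (hyperspace A).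
Proof.
rewrite eqEsubset; split=> C /=.
  by move=> [x [Cx nUx]] CU; apply/nUx/CU.
by move=> /existsNP[x /not_implyP[Cx nUx]]; exists x.
Qed.

(** The two halves of the subbase are complements of each other, so the
    hyperspace is zero-dimensional. *)
Lemma hyper_plus_clopen U :
  clopen U -> initial U -> clopen (hyper_plus U : set (hyperspace A)).
Proof.
move=> clU iU; split; first by apply: hyper_subbase_open; left; exists U.
rewrite -[hyper_plus U]setCK; apply: open_closedC; rewrite -hyper_minusC.
apply: hyper_subbase_open; right; exists (~` U) => //.
by split; [exact: clopenC|exact: final_setC].
Qed.

Lemma hyperspace_cvg (F : set_system (hyperspace A)) C : Filter F ->
  (forall O, hyper_subbase O -> O C -> F O) -> F --> C.
Proof.
move=> FF FO N; rewrite nbhsE => -[O [[DO sDO <-] [B DB BC]] BN].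
apply: filterS BN _; have [E sE EB] := sDO _ DB.
apply: (@filterS _ _ _ (\bigcap_(i in [set` E]) i)).
  by move=> D h; exists B => //; rewrite -EB.
apply: filter_bigI => i iE; apply: FO; first exact: set_mem (sE _ iE).
by move: BC; rewrite -EB; apply.
Qed.

(** An ultrafilter [F] on the hyperspace converges to the intersection [C0] of
    the clopen initial sets [U] with [hyper_plus U] in [F].  By compactness of
    [K_ A], a clopen set containing [C0] already contains one of these [U],
    since they are closed under finite intersection; for the empty set this
    shows that [C0] is nonempty.  Sets [hyper_minus V] containing [C0] belong to
    [F], otherwise [F] would contain [hyper_plus (~` V)]. *)
Lemma compact_hyperspace : compact [set: hyperspace A].
Proof.
rewrite compact_ultra => F UF _.
pose D := [set U | [/\ clopen U, initial U & F (hyper_plus U)]].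
pose C0 := \bigcap_(U in D) U.
have DT : D setT.
  by split; [exact: clopenT | by [] | apply: filterS filterT => C _].
have D_I U V : D U -> D V -> D (U `&` V).
  move=> [cU iU FU] [cV iV FV]; split; first exact: clopenI.
  - by move=> x y xy [Uy Vy]; split; [exact: iU xy Uy|exact: iV xy Vy].
  - apply: filterS (filterI FU FV) => C [CU CV] x Cx.
    by split; [exact: CU|exact: CV].
have C0_sub U : clopen U -> initial U -> C0 `<=` U -> F (hyper_plus U).
  move=> [oU cU] iU C0U; apply: contrapT => nFU.
  (* if no member of [D] is inside [U], a cluster point of these differences
     lies in [C0] and outside [U] *)
  pose G := filter_from D (fun V => V `\` U).
  have GF : ProperFilter G.
    apply: filter_from_proper.
      apply: filter_from_filter.
        by exists setT.
      move=> V W DV DW; exists (V `&` W); first exact: D_I.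
      by move=> x [[Vx Wx] nUx]; split; split.
    move=> V [_ _ FV]; apply: contrapT => VU; apply: nFU.
    apply: filterS FV => C CV x Cx; apply: contrapT => nUx.
    by apply: VU; exists x; split=> //; exact: CV.
  have [x [_ clx]] := one_point_compactification_compact _ GF filterT.
  have inV V W : closed W -> D V -> V `\` U `<=` W -> W x.
    move=> cW DV VW; apply: cW => N Nx; have := clx (V `\` U) N.
    case=> //; first by exists V.
    by move=> y [/VW Wy Ny]; exists y.
  have C0x : C0 x.
    by move=> V DV; apply: (inV V) => //; case: DV => -[].
  have nUx : (~` U) x.
    by apply: (inV setT) => //; exact: open_closedC.
  by apply: nUx; exact: C0U.
have C0_mem : C0 \in [set C | [/\ C !=set0, closed C & initial C]].
  apply/mem_set; split.
  - apply: contrapT => /nonemptyPn C00.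
    have /filter_ex[C] : F (hyper_plus set0).
      by apply: C0_sub; [exact: clopen0 | | rewrite C00].
    by have [[x Cx] _ _ /(_ _ Cx)] := hyperspaceP C.
  - by apply: closed_bigI => U [[]].
  - by move=> x y xy C0y U DU; case: (DU) => _ iU _; apply: iU xy _; exact: C0y.
exists (exist _ C0 C0_mem : hyperspace A); split=> //.
apply: hyperspace_cvg => O [[U [clU iU] <-]|[V [clV fV] <-]].
  exact: C0_sub.
rewrite -[V]setCK hyper_minusC => nC0V.
case: (in_ultra_setVsetC (hyper_plus (~` V)) UF) => // FV.
case: nC0V => x; apply; split=> //; first exact: clopenC.
exact: initial_setC.
Qed.

End HyperspaceTopology.

(** * The family of the sets of finite subsets *)

Section Star.
Context {S : choiceType}.
Implicit Types (X Y : set S) (F G : nefset S).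

Lemma fset1_neq0 (i : S) : [fset i]%fset != fset0.
Proof. by apply/fset0Pn; exists i; rewrite in_fset1. Qed.

Definition nef1 (i : S) : nefset S := exist _ [fset i]%fset (fset1_neq0 i).

Lemma nef1E i : nefset_set (nef1 i) = [set i].
Proof. by rewrite /nefset_set /= set_fset1. Qed.

Lemma nefset_set_inj : injective (@nefset_set S).
Proof.
move=> F G FG; apply: val_inj; apply/fsetP => i.
have FGi : nefset_set F i = nefset_set G i by rewrite FG.
by apply/idP/idP; rewrite /nefset_set /= in FGi; rewrite FGi.
Qed.

Lemma nefset_set_neq0 F : nefset_set F !=set0.
Proof. by have /fset0Pn[i iF] := valP F; exists i. Qed.

Lemma finite_nefset_set F : finite_set (nefset_set F).
Proof. exact: finite_fset. Qed.

Lemma finite_nefset X : finite_set X -> X !=set0 ->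
  exists F, nefset_set F = X.
Proof.
move=> /finite_fsetP[B ->] [i iB].
have B0 : B != fset0 by apply/fset0Pn; exists i.
by exists (exist _ B B0).
Qed.

Lemma star_nef1 X i : star X (nef1 i) <-> X i.
Proof. by rewrite /star /= nef1E sub1set inE. Qed.

Lemma star_inj : injective (@star S).
Proof.
by move=> X Y XY; apply/funext => i; apply/propext; rewrite -!star_nef1 XY.
Qed.

Lemma starI X Y : star X `&` star Y = star (X `&` Y).
Proof. by apply/funext => F; apply/propext; rewrite /star /= subsetI. Qed.

Lemma finite_star X : finite_set X -> finite_set (star X).
Proof.
move=> /finite_fsetP[B ->].
have -> : star [set` B] = val @^-1` [set` fpowerset B].
  apply/funext => F; apply/propext; rewrite /= fpowersetE.
  by split=> [h|/fsubsetP]//; apply/fsubsetP.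
apply: finite_preimage (finite_fset _).
by move=> F G _ _; exact: val_inj.
Qed.

Lemma infinite_star X : infinite_set X -> infinite_set (star X).
Proof.
move=> infX finsX; apply: infX.
have -> : X = nef1 @^-1` star X.
  by apply/funext => i; apply/propext; rewrite -star_nef1.
apply: finite_preimage finsX => i j _ _ ij.
have := nef1E i; rewrite ij nef1E => ji.
by have -> // : [set j] i; rewrite ji.
Qed.

Lemma star_family_almost_disjoint (L : set (set S)) :
  almost_disjoint L -> almost_disjoint (star_family L).
Proof.
move=> [Linf Lfin]; split=> [_ [X LX <-]|_ _ [X LX <-] [Y LY <-] XY].
  exact/infinite_star/Linf.
by rewrite starI; apply/finite_star/Lfin => // XY'; apply: XY; rewrite XY'.
Qed.

(** The same enumeration works.  A finite set [s] of finite sets has a finite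
    union, and [star X `&` star Y `<=` s] forces [X `&` Y] into that union, as
    one sees from singletons. *)
Lemma star_family_special_lusin (L : set (set S)) :
  special_lusin L -> special_lusin (star_family L).
Proof.
move=> [cI Lad [W [R [e [W1 e_inj eL lus]]]]]; split.
- have /countable_injP[f f_inj] := cI.
  pose g (F : nefset S) : {fset nat} := [fset f i | i in val F]%fset.
  apply/countable_injP; exists (choice.pickle \o g) => F G _ _.
  move=> /(pcan_inj choice.pickleK) gFG; apply: val_inj.
  have f_inj' : injective f by move=> i j; apply: f_inj; rewrite inE.
  have gP H i : (f i \in g H) = (i \in val H) by rewrite mem_imfset.
  by apply/fsetP => i; rewrite -!gP gFG.
- exact: star_family_almost_disjoint.
exists W, R, (@star S \o e); split=> //.
- by move=> x y /star_inj /e_inj.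
- by rewrite /star_family -eL image_comp.
move=> a s fins.
apply: sub_finite_set (lus a (\bigcup_(F in s) nefset_set F) _).
  move=> x [Rxa xa exa]; split=> // i [exi eai].
  exists (nef1 i); last by rewrite nef1E.
  by apply: exa; split; apply/star_nef1.
by apply: bigcup_finite => // F _; exact: finite_nefset_set.
Qed.

End Star.

(** * Traces of points in the hyperspace *)

Section Trace.
Context {S : choiceType} {L : set (set S)}.
Notation KL := (K_ L).
Notation KS := (K_ (star_family L)).
Implicit Types (x y : KS) (p : psi_space (star_family L)) (C : set KL).

(** The member of the hyperspace of [K_ L] that the canonical map attaches to
    [x].  On [inr B] the union has one term, for the [X] with [B = star X]; this
    avoids choosing [X]. *)
Definition trace x : set KL :=
  match x with
  | Some (inl F) => \bigcup_(i in nefset_set F) selector (K_pt i)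
  | Some (inr B) => \bigcup_(X in [set X : L | star (val X) = val B])
                      selector (K_set X)
  | None => setT
  end.

Lemma trace_ptE (F : nefset S) :
  trace (K_pt F) = [set K_pt i | i in nefset_set F].
Proof. by rewrite eqEsubset; split=> [_ [i Fi ->]|_ [i Fi <-]]; exists i. Qed.

Lemma trace_setE (X : L) (B : star_family L) :
  val B = star (val X) -> trace (K_set B) = selector (K_set X).
Proof.
move=> BX; rewrite eqEsubset; split=> [y [Y /= YB]|y Xy].
  by rewrite BX in YB; rewrite (val_inj (star_inj YB)).
by exists X.
Qed.

Lemma star_familyP (B : star_family L) : exists X : L, val B = star (val X).
Proof.
have [X LX XB] := set_mem (valP B).
by exists (exist _ X (mem_set LX)).
Qed.

Lemma trace_pt_ptP (F : nefset S) i :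
  trace (K_pt F) (K_pt i) <-> nefset_set F i.
Proof.
by rewrite trace_ptE; split=> [[j Fj /K_pt_inj <-]|Fi] //; exists i.
Qed.

Lemma trace_pt_setP (F : nefset S) (X : L) : ~ trace (K_pt F) (K_set X).
Proof. by rewrite trace_ptE => -[]. Qed.

Lemma trace_infty p : ~ trace (Some p) K_infty.
Proof.
case: p => [F|B]; first by rewrite -/(K_pt F) trace_ptE => -[].
by have [X BX] := star_familyP B; rewrite -/(K_set B) (trace_setE BX);
  exact: selector_infty.
Qed.

Lemma trace_inj : injective trace.
Proof.
have trace_pt_set F B : trace (K_pt F) <> trace (K_set B).
  have [X BX] := star_familyP B; rewrite (trace_setE BX) => FX.
  by apply: (@trace_pt_setP F X); rewrite FX; exact: selector_self.
have trace_top p : trace (Some p) <> setT.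
  by move=> pT; apply: (@trace_infty p); rewrite pT.
case=> [[F|B]|] [[G|D]|] //.
- move=> FG; congr (Some (inl _)); apply: nefset_set_inj.
  by apply/funext => i; apply/propext; rewrite -!trace_pt_ptP /K_pt FG.
- by move=> /trace_pt_set.
- by move=> /trace_top.
- by move=> /esym/trace_pt_set.
- have [X BX] := star_familyP B; have [Y DY] := star_familyP D.
  rewrite -/(K_set B) -/(K_set D) (trace_setE BX) (trace_setE DY) => XY.
  congr (Some (inr _)); apply: val_inj; rewrite BX DY.
  by have /selector_set-> : selector (K_set Y) (K_set X)
    by rewrite -XY; exact: selector_self.
- by move=> /trace_top.
- by move=> /esym/trace_top.
- by move=> /esym/trace_top.
Qed.

(** Inclusion of traces is a partial order.  Its greatest element [K_infty]
    alone has no [Some p] above it, and any other point is its own least upper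
    bound. *)
Lemma trace_separates x y :
  (forall p, trace x `<=` trace (Some p) <-> trace y `<=` trace (Some p)) ->
  x = y.
Proof.
move=> xy; apply: trace_inj.
case: x y xy => [p|] [q|] // xy.
- by rewrite eqEsubset; split; apply/xy.
- have /xy/(_ K_infty Logic.I) : trace (Some p) `<=` trace (Some p) by [].
  by move/trace_infty.
- have /xy/(_ K_infty Logic.I) : trace (Some q) `<=` trace (Some q) by [].
  by move/trace_infty.
Qed.

Lemma trace_initial x : initial (trace x).
Proof.
case: x => [[F|B]|] //; apply: initial_bigcup => i _; exact: initial_selector.
Qed.

Lemma trace_neq0 x : trace x !=set0.
Proof.
case: x => [[F|B]|]; last by exists K_infty.
  have [i Fi] := nefset_set_neq0 F.
  by exists (K_pt i); apply/trace_pt_ptP.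
have [X BX] := star_familyP B; exists (K_set X).
by rewrite -/(K_set B) (trace_setE BX); exact: selector_self.
Qed.

Context (Lad : almost_disjoint L).

Lemma trace_clopen p : clopen (trace (Some p)).
Proof.
case: p => [F|B].
  apply: clopen_bigcup_finite; first exact: finite_nefset_set.
  by move=> i _; exact: selector_clopen.
have [X BX] := star_familyP B.
by rewrite -/(K_set B) (trace_setE BX); exact: selector_clopen.
Qed.

Lemma trace_closed x : closed (trace x).
Proof. by case: x => [p|]; [case: (trace_clopen p)|exact: closedT]. Qed.

Lemma trace_pt_sub (F : nefset S) C :
  trace (K_pt F) `<=` C <-> (forall i, nefset_set F i -> C (K_pt i)).
Proof.
split=> [FC i Fi|FC]; first exact/FC/trace_pt_ptP.
by rewrite trace_ptE => _ [i Fi <-]; exact: FC.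
Qed.

(** The lower set of a finite set is a finite union of isolated points, and that
    of [K_set B] is the selector of [K_set B]. *)
Lemma trace_lower_clopen p :
  clopen [set x : KS | trace x `<=` trace (Some p)].
Proof.
have Lad' := star_family_almost_disjoint Lad.
case: p => [F|B].
  have -> : [set x : KS | trace x `<=` trace (K_pt F)] =
      \bigcup_(G in star (nefset_set F)) selector (K_pt G).
    rewrite eqEsubset; split=> [[[G|B]|]|_ [G FG ->]].
    - move=> /(@trace_pt_sub G) GF; exists G => // i Gi.
      exact/trace_pt_ptP/GF.
    - have [X BX] := star_familyP B; rewrite mksetE -/(K_set B) (trace_setE BX).
      by move=> /(_ _ (selector_self (inr X)))/trace_pt_setP.
    - by move=> /(_ K_infty Logic.I)/trace_infty.
    by apply/trace_pt_sub => i Gi; apply/trace_pt_ptP; exact: FG.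
  apply: clopen_bigcup_finite => [|G _]; last exact: selector_clopen.
  exact/finite_star/finite_nefset_set.
have [X BX] := star_familyP B; rewrite -/(K_set B) (trace_setE BX).
have -> : [set x : KS | trace x `<=` selector (K_set X)] = selector (K_set B).
  rewrite eqEsubset; split=> [[[G|D]|]|[[G|D]|]].
  - move=> /(@trace_pt_sub G) GX; apply/selector_pt; rewrite BX => i Gi.
    exact/selector_pt/GX.
  - have [Y DY] := star_familyP D; rewrite mksetE -/(K_set D) (trace_setE DY).
    move=> /(_ _ (selector_self (inr Y)))/selector_set YX.
    by apply/selector_set/val_inj; rewrite BX DY YX.
  - by move=> /(_ K_infty Logic.I)/selector_infty.
  - move=> /selector_pt; rewrite BX => GX.
    by apply/(@trace_pt_sub G) => i /GX Xi; apply/selector_pt.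
  - by move=> /selector_set ->; rewrite mksetE -/(K_set B) (trace_setE BX).
  - by move=> /selector_infty.
exact: selector_clopen.
Qed.

(** Inside the selector of [K_set X], the set [C] either contains the limit
    point [K_set X], and then all of its selector, or has finitely many points,
    because its complement is a neighbourhood of [K_set X]. *)
Lemma trace_sub_trace C p :
  C !=set0 -> closed C -> initial C -> C `<=` trace (Some p) ->
  exists x, trace x = C.
Proof.
move=> [c Cc] clC iC.
have finite_case : (forall z, C z -> exists i, z = K_pt i) ->
    finite_set [set i | C (K_pt i)] -> exists x, trace x = C.
  move=> Cpt finC; have [i ci] := Cpt _ Cc.
  have [|F FE] := finite_nefset finC; first by exists i; rewrite /= -ci.
  exists (K_pt F); rewrite trace_ptE FE eqEsubset.
  split=> [_ [j Cj <-]//|y Cy].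
  by have [j jE] := Cpt _ Cy; exists j; rewrite /= -?jE.
case: p => [F|B].
  rewrite -/(K_pt F) trace_ptE => CF; apply: finite_case.
    by move=> y /CF [i _ <-]; exists i.
  apply: sub_finite_set (finite_nefset_set F) => i /CF [j Fj].
  by move=> /K_pt_inj <-.
have [X BX] := star_familyP B; rewrite -/(K_set B) (trace_setE BX) => CX.
have [CKX|nCX] := pselect (C (K_set X)).
  exists (K_set B); rewrite (trace_setE BX) eqEsubset; split=> // y Xy.
  by apply: iC CKX; exact: selector_le.
apply: finite_case.
  move=> [[i|Y]|] Cy; first by exists i.
    by case: nCX; have /selector_set <- := CX _ Cy.
  by have /selector_infty := CX _ Cy.
have := closed_openC clC; rewrite openE => /(_ _ nCX)/nbhs_K_set[_].
apply: sub_finite_set => i Ci; split; first exact/selector_pt/CX.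
by move=> /(_ Ci).
Qed.

(** The chosen point is unique, because [trace] is injective. *)
Definition collapse C : KS := xget K_infty [set x | trace x = C].

Lemma collapseK C : (exists x, trace x = C) -> trace (collapse C) = C.
Proof. exact: xgetPex. Qed.

Lemma collapse_infty C : (forall p, trace (Some p) <> C) ->
  collapse C = K_infty.
Proof.
by move=> nC; rewrite /collapse; case: xgetP => // -[p _ /nC|].
Qed.

(** [collapse] moves only sets that are no traces; these lie below no [Some p],
    and neither does their image [K_infty]. *)
Lemma trace_collapse C p : C !=set0 -> closed C -> initial C ->
  trace (collapse C) `<=` trace (Some p) <-> C `<=` trace (Some p).
Proof.
move=> C0 clC iC.
have [/collapseK->//|noC] := pselect (exists x, trace x = C).
rewrite collapse_infty => [|q qC]; last by apply: noC; exists (Some q).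
split; first by move=> /(_ K_infty Logic.I)/trace_infty.
by move=> /(trace_sub_trace C0 clC iC)/noC.
Qed.

Lemma traceK x : collapse (trace x) = x.
Proof.
apply: trace_separates => p; apply: trace_collapse.
- exact: trace_neq0.
- exact: trace_closed.
- exact: trace_initial.
Qed.

Lemma hausdorff_K_star : hausdorff_space KS.
Proof. exact: hausdorff_separated trace_lower_clopen trace_separates. Qed.

Lemma continuous_trace_lower (T : topologicalType) (f : T -> KS) :
  (forall p, clopen [set t | trace (f t) `<=` trace (Some p)]) ->
  continuous f.
Proof.
move=> clf.
apply: continuous_separated trace_lower_clopen trace_separates _ _ _ clf.
exact: one_point_compactification_compact.
Qed.

(** ** The semilattice structure *)

Definition trace_join x y : KS := collapse (trace x `|` trace y).

(** Below [K_infty] this is the universal property of a least upper bound, and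
    with [trace_separates] it gives all the semilattice laws; it also presents
    the preimage of a basic clopen set as a product of two clopen sets. *)
Lemma trace_join_lower x y p :
  trace (trace_join x y) `<=` trace (Some p) <->
  trace x `<=` trace (Some p) /\ trace y `<=` trace (Some p).
Proof.
rewrite -subUset; apply: trace_collapse.
- by have [z xz] := trace_neq0 x; exists z; left.
- by apply: closedU; exact: trace_closed.
- by apply: initialU; exact: trace_initial.
Qed.

Lemma trace_join_semilattice : join_semilattice_op trace_join.
Proof.
split.
- by move=> x y z; apply: trace_separates => p;
  rewrite !trace_join_lower; tauto.
- by move=> x y; apply: trace_separates => p;
  rewrite !trace_join_lower; tauto.
- by move=> x; apply: trace_separates => p;
  rewrite !trace_join_lower; tauto.
apply: continuous_trace_lower => p.
have -> : [set t : KS * KS | trace (trace_join t.1 t.2) `<=` trace (Some p)] =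
    (fst @^-1` [set x | trace x `<=` trace (Some p)]) `&`
    (snd @^-1` [set x | trace x `<=` trace (Some p)]).
  by apply/funext => t; apply/propext; exact: trace_join_lower.
by apply: clopenI; apply: preimage_clopen (trace_lower_clopen p) _ => t;
  [exact: cvg_fst|exact: cvg_snd].
Qed.

(** ** The collapsed hyperspace *)

Lemma trace_hyper x :
  trace x \in [set C | [/\ C !=set0, closed C & initial C]].
Proof.
apply/mem_set; split.
- exact: trace_neq0.
- exact: trace_closed.
- exact: trace_initial.
Qed.

Definition hyper_trace x : hyperspace L := exist _ (trace x) (trace_hyper x).

Lemma collapsedP (C : hyperspace L) :
  collapsed C <-> (forall p, trace (Some p) <> sval C).
Proof.
split=> [[nF nX] [F|B]|h].
- move=> FC; apply: nF; exists F.
  by rewrite /fin_member -FC -/(K_pt F) trace_ptE.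
- have [X BX] := star_familyP B; move=> BC; apply: nX; exists X.
  by rewrite /set_member -BC -/(K_set B) (trace_setE BX).
split=> [[F FC]|[X XC]].
  by apply: (h (inl F)); rewrite FC -/(K_pt F) trace_ptE.
have BL : star (val X) \in star_family L.
  by apply/mem_set; exists (val X) => //; exact: set_mem (valP X).
pose B : star_family L := exist _ (star (val X)) BL.
by apply: (h (inr B)); rewrite XC -/(K_set B) (trace_setE (X := X)).
Qed.

Lemma collapsed_collapse (C : hyperspace L) :
  collapsed C -> collapse (sval C) = K_infty.
Proof. by move=> /collapsedP; exact: collapse_infty. Qed.

Lemma collapse_Some C p : collapse C = Some p -> C = trace (Some p).
Proof.
move=> Cp; have [/collapseK<-|noC] := pselect (exists x, trace x = C).
  by rewrite Cp.
by rewrite collapse_infty // in Cp => q qC; apply: noC; exists (Some q).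
Qed.

(** The collapsing relation is the kernel of [collapse], so the quotient is the
    image of [collapse] as a set. *)
Lemma collapse_relP (C D : hyperspace L) :
  collapse_rel C D <-> collapse (sval C) = collapse (sval D).
Proof.
split=> [/asboolP[->//|[cC cD]]|CD].
  by rewrite !collapsed_collapse.
apply/asboolP; case E: (collapse (sval C)) => [p|].
  left; apply: val_inj; rewrite /= (collapse_Some E).
  by rewrite CD in E; rewrite (collapse_Some E).
have collapsed_None M : collapse (sval M) = None -> collapsed M.
  by move=> M0; apply/collapsedP => p pM; move: M0; rewrite -pM traceK.
by right; split; apply: collapsed_None; rewrite -?CD.
Qed.

Lemma continuous_collapse :
  continuous (fun C : hyperspace L => collapse (sval C)).
Proof.
apply: continuous_trace_lower => p.
have -> : [set C : hyperspace L |
    trace (collapse (sval C)) `<=` trace (Some p)] =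
    hyper_plus (trace (Some p)).
  apply/funext => C; apply/propext; apply: trace_collapse;
  by have [] := hyperspaceP C.
by apply: hyper_plus_clopen; [exact: trace_clopen|exact: trace_initial].
Qed.

Definition G_to_K (c : G_space L) : KS := collapse (sval (repr c)).

Definition K_to_G x : G_space L := G_class (hyper_trace x).

Lemma G_classP (C D : hyperspace L) :
  G_class C = G_class D <-> collapse (sval C) = collapse (sval D).
Proof.
by rewrite -collapse_relP; split=> [/eqmodP//|CD]; exact/eqmodP.
Qed.

Lemma G_to_KK : cancel G_to_K K_to_G.
Proof.
move=> c; rewrite -[RHS]reprK; apply/G_classP.
by rewrite /= traceK.
Qed.

Lemma K_to_GK : cancel K_to_G G_to_K.
Proof.
move=> x; rewrite -[RHS]traceK /G_to_K.
by apply/(G_classP _ (hyper_trace x)); rewrite /G_class reprK.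
Qed.

Lemma continuous_G_to_K : continuous G_to_K.
Proof.
apply: (@repr_comp_continuous _ {eq_quot (@collapse_rel _ L)}%qT _
  (fun C : hyperspace L => collapse (sval C))).
  exact: continuous_collapse.
by move=> C D /eqP/G_classP ->.
Qed.

Lemma compact_G_space : compact [set: G_space L].
Proof.
have -> : [set: G_space L] = @G_class _ L @` setT.
  apply/esym; rewrite eqEsubset; split=> // c _.
  by exists (repr c) => //; exact: reprK.
apply: continuous_compact; last exact: compact_hyperspace.
by apply: continuous_subspaceT; exact: pi_continuous.
Qed.

(** The inverse of the canonical map is a continuous bijection from a compact
    space to a Hausdorff space. *)
Lemma K_to_G_homeomorphism : homeomorphism K_to_G.
Proof.
split; last by exists G_to_K; split;
  [exact: K_to_GK|exact: G_to_KK|exact: continuous_G_to_K].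
apply: (compact_hausdorff_continuous_inverse compact_G_space hausdorff_K_star
  continuous_G_to_K); [exact: G_to_KK|exact: K_to_GK].
Qed.

Lemma K_to_G_canonical : canonical_map K_to_G.
Proof.
split.
- by move=> F; exists (hyper_trace (K_pt F)); rewrite // /fin_member -trace_ptE.
- move=> X B BX; exists (hyper_trace (K_set B)) => //.
  exact: trace_setE.
exists (hyper_trace K_infty) => //; apply/collapsedP => p pT.
by apply: (@trace_infty p); rewrite pT.
Qed.

End Trace.

Theorem proposition4p14 (L : set (set nat)) (hL : special_lusin L) :
  special_lusin (star_family L) /\
  (exists h : K_ (star_family L) -> G_space L,
     homeomorphism h /\ canonical_map h) /\
  (exists op : K_ (star_family L) -> K_ (star_family L) -> K_ (star_family L),
     join_semilattice_op op).
Proof.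
have Lad : almost_disjoint L by case: hL.
split; first exact: star_family_special_lusin.
split; last by exists trace_join; exact: trace_join_semilattice.
exists (K_to_G Lad); split; first exact: K_to_G_homeomorphism.
exact: K_to_G_canonical.
Qed.
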